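(* Let $L$ be a restricted Lie superalgebra over $\mathbb{K}$ and $M$ a restricted $L$-module. For every linear map $\psi:L\to M$, one has $d^1_*\psi\in C^2_*(L;M)$ and $d^2_*(d^1_*\psi)=0$; that is, $d^2_{\mathrm{CE}}(d^1_{\mathrm{CE}}\psi)=0$ and $\operatorname{ind}^2\bigl(d^1_{\mathrm{CE}}\psi,\operatorname{ind}^1(\psi)\bigr)=0$. Hence $H^2_*(L;M):=\ker d^2_*/\operatorname{im} d^1_*$ is well defined.
   Context: $\mathbb{K}$ is a field of characteristic $p>2$; Lie superalgebras satisfy $[x,[x,x]]=0$ for odd $x$. A restricted Lie superalgebra has a map $x\mapsto x^{[p]}$ on $L_{\bar0}$ making $L_{\bar0}$ a restricted Lie algebra and with $\mathrm{ad}_{x^{[p]}}(y)=(\mathrm{ad}_x)^p(y)$ for $x\in L_{\bar0},y\in L$. A restricted $L$-module $M$ is a $\mathbb{Z}_2$-graded module with $x^p\cdot m=x^{[p]}\cdot m$ for $x\in L_{\bar0}$ ($x^p$ = acting $p$ times). For homogeneous $\psi\in C^1_{\mathrm{CE}}(L;M)=\mathrm{Hom}_{\mathbb{K}}(L,M)$: $d^1_{\mathrm{CE}}\psi(u,v)=\psi([u,v])-(-1)^{|u||\psi|}u\cdot\psi(v)+(-1)^{|v|(|\psi|+|u|)}v\cdot\psi(u)$, and $\operatorname{ind}^1(\psi):L_{\bar0}\to M$, $\operatorname{ind}^1(\psi)(x)=\psi(x^{[p]})-x^{p-1}\psi(x)$; $d^1_*\psi:=(d^1_{\mathrm{CE}}\psi,\operatorname{ind}^1\psi)$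 (extended additively to non-homogeneous $\psi$). $d^2_{\mathrm{CE}}$ is given by $d^2_{\mathrm{CE}}\varphi(u,v,w)=\varphi([u,v],w)-(-1)^{|v||w|}\varphi([u,w],v)-\varphi(u,[v,w])-(-1)^{|u||\varphi|}u\cdot\varphi(v,w)+(-1)^{|v|(|\varphi|+|u|)}v\cdot\varphi(u,w)-(-1)^{|w|(|\varphi|+|u|+|v|)}w\cdot\varphi(u,v)$. $C^2_*(L;M)$ is the set of pairs $(\varphi,\omega)$, $\varphi$ a super-alternating bilinear map $L\times L\to M$, $\omega:L_{\bar0}\to M$ $\varphi$-compatible, meaning $\omega(\lambda x)=\lambda^p\omega(x)$ and $\omega(x+y)=\omega(x)+\omega(y)+\sum\frac1{\sharp(x)}\varphi([x_1,\dots,x_{p-1}],x_p)+\sum\frac1{\sharp(x)}\sum_{k=1}^{p-2}(-1)^kx_p\cdots x_{p-k+1}\varphi([x_1,\dots,x_{p-k-1}],x_{p-k})$ (sums over $x_i\in\{x,y\}$, $x_1=x,x_2=y$; $\sharp(x)=\#\{k:x_k=x\}$; $[x_1,\dots,x_k]=[[\cdots[x_1,x_2],\dots],x_k]$). For $\varphi$ homogeneous and $\omega$ with values in $M_{|\varphi|}$, $\operatorname{ind}^2(\varphi,\omega)(x,y)=\varphi(x,y^{[p]})-\sum_{i+j=p-1}(-1)^iy^i\varphi([x,y,\dots,y\ (j\text{ times})],y)+(-1)^{|\varphi||x|}x\cdot\omega(y)$ for $x\in L$, $y\in L_{\bar0}$, extended additively via the decomposition $(\varphi,\omega)=(\varphi_{\bar0},\omega_{\bar0})+(\varphi_{\bar1},\omega_{\bar1})$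 ($\omega_{\bar j}$ = $M_{\bar j}$-component). $d^2_*(\varphi,\omega)=(d^2_{\mathrm{CE}}\varphi,\operatorname{ind}^2(\varphi,\omega))$. *)

(* Defs.v *)
From mathcomp Require Import all_boot all_order all_algebra.
Set Implicit Arguments. Unset Strict Implicit. Unset Printing Implicit Defensive.
Import GRing.Theory.
Local Open Scope ring_scope.

(* Z_2-gradings are encoded by parity projections  par : bool -> V -> V
   (false = even component, true = odd component).  Degrees are booleans,
   degree addition is addb, and (-1)^(a b) is  sgn (a && b). *)

Section SuperCochains.
Variable K : fieldType.
Variable p : nat.

Definition sgn (b : bool) : K := if b then -1 else 1.

Definition bilin (U V W : lmodType K) (f : U -> V -> W) : Prop :=
  (forall u, linear (f u)) /\ (forall v, linear (fun u => f u v)).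

Definition grading (V : lmodType K) (par : bool -> V -> V) : Prop :=
  [/\ forall b, linear (par b),
      forall v, par false v + par true v = v &
      forall b c v, par b (par c v) = if b == c then par c v else 0].

Definition homog (V : lmodType K) (par : bool -> V -> V) (a : bool) (v : V) :=
  par a v = v.

Section WithL.
Variable L : lmodType K.
Variable parL : bool -> L -> L.
Variable br : L -> L -> L.
Variable pm : L -> L.

Definition lbr (s : seq L) : L :=
  if s is x :: s' then foldl br x s' else 0.

(* the words x1 = x, x2 = y, x3..xp in {x,y}, encoded by booleans
   (false <-> x, true <-> y) *)
Definition bword (t : {ffun 'I_(p - 2) -> bool}) : seq bool :=
  false :: true :: [seq t i | i <- enum 'I_(p - 2)].

Definition word (x y : L) (t : {ffun 'I_(p - 2) -> bool}) : seq L :=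
  [seq (if b then y else x) | b <- bword t].

Definition nx (t : {ffun 'I_(p - 2) -> bool}) : nat := count negb (bword t).

Definition jac_sum (x y : L) : L :=
  \sum_(t : {ffun 'I_(p - 2) -> bool}) ((nx t)%:R)^-1 *: lbr (word x y t).

Definition lie_superalgebra : Prop :=
  [/\ grading parL /\ bilin br,
      forall a b u v, homog parL a u -> homog parL b v ->
        homog parL (addb a b) (br u v),
      forall a b u v, homog parL a u -> homog parL b v ->
        br u v = - (sgn (a && b) *: br v u),
      forall a b c u v w, homog parL a u -> homog parL b v -> homog parL c w ->
        sgn (a && c) *: br u (br v w) + sgn (b && a) *: br v (br w u)
        + sgn (c && b) *: br w (br u v) = 0 &
      forall x, homog parL true x -> br x (br x x) = 0].

Definition restricted_lie_superalgebra : Prop :=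
  [/\ lie_superalgebra,
      forall x, homog parL false x -> homog parL false (pm x),
      forall (l : K) x, homog parL false x -> pm (l *: x) = l ^+ p *: pm x,
      forall x y, homog parL false x -> homog parL false y ->
        pm (x + y) = pm x + pm y + jac_sum x y &
      forall x y, homog parL false x -> br (pm x) y = iter p (br x) y].

Section WithM.
Variable M : lmodType K.
Variable parM : bool -> M -> M.
Variable act : L -> M -> M.

Definition restricted_module : Prop :=
  [/\ grading parM, bilin act,
      forall a b u m, homog parL a u -> homog parM b m ->
        homog parM (addb a b) (act u m),
      forall a b u v m, homog parL a u -> homog parL b v ->
        act (br u v) m = act u (act v m) - sgn (a && b) *: act v (act u m) &
      forall x m, homog parL false x -> iter p (act x) m = act (pm x) m].

Definition comp1 (j : bool) (psi : L -> M) (u : L) : M :=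
  \sum_(a : bool) parM (addb a j) (psi (parL a u)).

Definition comp2 (j : bool) (phi : L -> L -> M) (u v : L) : M :=
  \sum_(a : bool) \sum_(b : bool) parM (addb (addb a b) j) (phi (parL a u) (parL b v)).

(* d^1_CE for psi homogeneous of degree j, u of degree a, v of degree b *)
Definition d1h (j a b : bool) (psi : L -> M) (u v : L) : M :=
  psi (br u v) - sgn (a && j) *: act u (psi v)
  + sgn (b && addb j a) *: act v (psi u).

Definition d1CE (psi : L -> M) (u v : L) : M :=
  \sum_(j : bool) \sum_(a : bool) \sum_(b : bool)
     d1h j a b (comp1 j psi) (parL a u) (parL b v).

Definition ind1 (psi : L -> M) (x : L) : M :=
  psi (pm x) - iter p.-1 (act x) (psi x).

Definition d2h (j a b c : bool) (phi : L -> L -> M) (u v w : L) : M :=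
  phi (br u v) w - sgn (b && c) *: phi (br u w) v - phi u (br v w)
  - sgn (a && j) *: act u (phi v w)
  + sgn (b && addb j a) *: act v (phi u w)
  - sgn (c && addb (addb j a) b) *: act w (phi u v).

Definition d2CE (phi : L -> L -> M) (u v w : L) : M :=
  \sum_(j : bool) \sum_(a : bool) \sum_(b : bool) \sum_(c : bool)
     d2h j a b c (comp2 j phi) (parL a u) (parL b v) (parL c w).

(* x_p x_{p-1} ... x_{p-k+1} . m  (x_p acting last) *)
Definition act_tail (s : seq L) (k : nat) (m : M) : M :=
  foldr act m (rev (drop (size s - k) s)).

Definition compat_term (phi : L -> L -> M) (s : seq L) : M :=
  phi (lbr (take p.-1 s)) (nth 0 s p.-1)
  + \sum_(1 <= k < p.-1)
      (-1) ^+ k *: act_tail s k (phi (lbr (take (p - k - 1) s)) (nth 0 s (p - k - 1))).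

Definition super_alternating (phi : L -> L -> M) : Prop :=
  forall a b u v, homog parL a u -> homog parL b v ->
    phi u v = - (sgn (a && b) *: phi v u).

Definition phi_compatible (phi : L -> L -> M) (omega : L -> M) : Prop :=
  (forall (l : K) x, homog parL false x -> omega (l *: x) = l ^+ p *: omega x) /\
  (forall x y, homog parL false x -> homog parL false y ->
     omega (x + y) = omega x + omega y
       + \sum_(t : {ffun 'I_(p - 2) -> bool})
            ((nx t)%:R)^-1 *: compat_term phi (word x y t)).

(* C^2_*(L;M) ; omega is only meaningful on L_0 *)
Definition inC2 (phi : L -> L -> M) (omega : L -> M) : Prop :=
  [/\ bilin phi, super_alternating phi & phi_compatible phi omega].

(* ind^2 for phi homogeneous of degree j, omega with values in M_j,
   x of degree a, y even *)
Definition ind2h (j a : bool) (phi : L -> L -> M) (omega : L -> M) (x y : L) : M :=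
  phi x (pm y)
  - \sum_(i < p) (-1) ^+ i *: iter i (act y) (phi (iter (p.-1 - i) (br^~ y) x) y)
  + sgn (j && a) *: act x (omega y).

Definition ind2 (phi : L -> L -> M) (omega : L -> M) (x y : L) : M :=
  \sum_(j : bool) \sum_(a : bool)
     ind2h j a (comp2 j phi) (fun z => parM j (omega z)) (parL a x) y.

End WithM.
End WithL.
End SuperCochains.

(* Main.v *)
From HB Require Import structures.
Require Import Defs.
From mathcomp Require Import all_boot all_order all_algebra.
From mathcomp Require Import boolp.
Set Implicit Arguments. Unset Strict Implicit. Unset Printing Implicit Defensive.
Import GRing.Theory.
Local Open Scope ring_scope.

(** Writing c_k for [x_1, ..., x_k] and phi = d^1 psi, the sum in the compatibility
    condition telescopes to psi(c_p) - E(x_1, ..., x_p), where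
    E(x_1, ..., x_k) = c_{k-1} psi(x_k) - x_k E(x_1, ..., x_{k-1}).  If u acts on M + K by
    rho(u)(m, t) = (u m + t psi(u), 0), then E is the left-normed commutator of
    rho(x_1), ..., rho(x_p) evaluated at (0, 1), while rho(x)^p (0, 1) = (x^{p-1} psi(x), 0).
    Compatibility of ind^1 psi is therefore Jacobson's formula for (rho(x) + rho(y))^p
    in the ring of additive endomorphisms of M + K.  Jacobson's formula comes from
    differentiating (X T + Y)^p in the polynomial ring in T.

    The sum in ind^2 telescopes as well, up to sum_i (-1)^i y^i [x, y, ..., y] psi(y) with
    p-1-i letters y in the bracket; this equals x y^{p-1} psi(y).  This identity and the one
    used for Jacobson's formula are both instances of
    sum_{i<p} a^i b^{p-1-i} = (b - a)^{p-1}, valid for commuting a, b in characteristic p,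
    where a, b are built from left and right multiplication by y. *)

(** * The ring of additive endomorphisms of an abelian group *)

Record endo (V : zmodType) := Endo {
  endo_fun :> V -> V;
  endoD : {morph endo_fun : u v / u + v} }.

Section EndoRing.
Variable V : zmodType.
Implicit Types f g : endo V.

HB.instance Definition _ := gen_eqMixin (endo V).
HB.instance Definition _ := gen_choiceMixin (endo V).

Lemma endo_ext f g : f =1 g -> f = g.
Proof.
case: f g => f fD [g gD] /= /funext fg; rewrite fg in fD *.
by congr Endo; apply: Prop_irrelevance.
Qed.

Fact endo_add_subproof f g : {morph (fun v => f v + g v) : u v / u + v}.
Proof. by move=> u v; rewrite !endoD addrACA. Qed.

Fact endo_opp_subproof f : {morph (fun v => - f v) : u v / u + v}.
Proof. by move=> u v; rewrite endoD opprD. Qed.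

Fact endo_zero_subproof : {morph (fun _ : V => 0 : V) : u v / u + v}.
Proof. by move=> u v; rewrite addr0. Qed.

Fact endo_mul_subproof f g : {morph (fun v => f (g v)) : u v / u + v}.
Proof. by move=> u v; rewrite !endoD. Qed.

Fact endo_one_subproof : {morph (fun v : V => v) : u v / u + v}.
Proof. by []. Qed.

Definition endo_add f g := Endo (endo_add_subproof f g).
Definition endo_opp f := Endo (endo_opp_subproof f).
Definition endo_zero := Endo endo_zero_subproof.
Definition endo_mul f g := Endo (endo_mul_subproof f g).
Definition endo_one := Endo endo_one_subproof.

Fact endo_addA : associative endo_add.
Proof. by move=> f g h; apply: endo_ext => v /=; rewrite addrA. Qed.
Fact endo_addC : commutative endo_add.
Proof. by move=> f g; apply: endo_ext => v /=; rewrite addrC. Qed.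
Fact endo_add0 : left_id endo_zero endo_add.
Proof. by move=> f; apply: endo_ext => v /=; rewrite add0r. Qed.
Fact endo_addN : left_inverse endo_zero endo_opp endo_add.
Proof. by move=> f; apply: endo_ext => v /=; rewrite addNr. Qed.

HB.instance Definition _ :=
  GRing.isZmodule.Build (endo V) endo_addA endo_addC endo_add0 endo_addN.

Fact endo_mulA : associative endo_mul.
Proof. by move=> f g h; apply: endo_ext. Qed.
Fact endo_mul1l : left_id endo_one endo_mul.
Proof. by move=> f; apply: endo_ext. Qed.
Fact endo_mul1r : right_id endo_one endo_mul.
Proof. by move=> f; apply: endo_ext. Qed.
Fact endo_mulDl : left_distributive endo_mul +%R.
Proof. by move=> f g h; apply: endo_ext. Qed.
Fact endo_mulDr : right_distributive endo_mul +%R.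
Proof. by move=> f g h; apply: endo_ext => v /=; rewrite endoD. Qed.

(** When [V] is trivial this is the zero ring, hence a [pzRingType] only. *)
HB.instance Definition _ := GRing.Zmodule_isPzRing.Build (endo V)
  endo_mulA endo_mul1l endo_mul1r endo_mulDl endo_mulDr.

Lemma endo_addE f g v : (f + g) v = f v + g v. Proof. by []. Qed.
Lemma endo_oppE f v : (- f) v = - f v. Proof. by []. Qed.
Lemma endo_mulE f g v : (f * g) v = f (g v). Proof. by []. Qed.

Lemma endo_sumE I (r : seq I) (P : pred I) (F : I -> endo V) v :
  (\sum_(i <- r | P i) F i) v = \sum_(i <- r | P i) F i v.
Proof. by elim/big_rec2: _ => // i u f _ <-. Qed.

Lemma endo_mulrnE f n v : (f *+ n) v = f v *+ n.
Proof. by elim: n => // n IHn; rewrite !mulrS endo_addE IHn. Qed.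

Lemma endo_exprE f n v : (f ^+ n) v = iter n f v.
Proof. by elim: n => // n IHn; rewrite exprS endo_mulE IHn. Qed.

End EndoRing.

(** * Binomial sums and iterated commutators in characteristic p *)

Definition comm_bracket (R : pzRingType) (u v : R) : R := u * v - v * u.
Local Notation cbr := (@comm_bracket _).

Section CharP.
Variables (R : pzRingType) (p : nat).
Hypotheses (p_pr : prime p) (Rp : p%:R = 0 :> R).

Lemma natr_dvd0 n : (p %| n)%N -> n%:R = 0 :> R.
Proof. by case/dvdnP=> k ->; rewrite natrM Rp mulr0. Qed.

(** By Pascal's rule C(p-1, k) + C(p-1, k+1) = C(p, k+1), which vanishes mod p, so consecutive
    entries of row p-1 are opposite. *)
Lemma signed_bin_pred k : (k < p)%N -> (-1) ^+ k * 'C(p.-1, k)%:R = 1 :> R.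
Proof.
elim: k => [|k IHk] ltkp; first by rewrite bin0 mul1r.
have p0 := prime_gt0 p_pr.
have /natr_dvd0 : (p %| 'C(p.-1.+1, k.+1))%N by rewrite prednK // prime_dvd_bin.
rewrite binS natrD => /eqP; rewrite addr_eq0 => /eqP ->.
by rewrite exprS mulN1r mulrNN IHk // ltnW.
Qed.

(** Binomial expansion of the right-hand side, where [signed_bin_pred] turns every coefficient into
    1. *)
Lemma sum_exprM_comm (a b : R) : GRing.comm a b ->
  \sum_(i < p) a ^+ i * b ^+ (p.-1 - i) = (b - a) ^+ p.-1.
Proof.
move=> cab; rewrite (exprBn_comm _ (commr_sym cab)) prednK ?prime_gt0 //.
apply: eq_bigr => i _.
rewrite -mulr_natl -signr_odd !mulrA.
have -> : 'C(p.-1, i)%:R * (-1) ^+ odd i = 1 :> R.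
  by rewrite signr_odd -commr_nat signed_bin_pred.
by rewrite mul1r; apply/commrX/commr_sym/commrX/commr_sym.
Qed.

Lemma mulrn_p0 (x : R) : x *+ p = 0.
Proof. by rewrite -mulr_natl Rp mul0r. Qed.

End CharP.

Section AdPower.
Variables (R : pzRingType) (p : nat).
Hypotheses (p_pr : prime p) (Rp : p%:R = 0 :> R).

Definition lmul (z : R) : endo R := Endo (mulrDr z).
Definition rmul (z : R) : endo R := Endo (fun u v => mulrDl u v z).

Lemma lmulX z n x : (lmul z ^+ n) x = z ^+ n * x.
Proof. by elim: n => [|n IHn]; rewrite ?mul1r // exprS endo_mulE IHn /= mulrA -exprS. Qed.

Lemma rmulX z n x : (rmul z ^+ n) x = x * z ^+ n.
Proof. by elim: n => [|n IHn]; rewrite ?mulr1 // exprS endo_mulE IHn /= -mulrA -exprSr. Qed.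

Lemma comm_lrmul z : GRing.comm (lmul z) (rmul z).
Proof. by apply: endo_ext => x /=; rewrite mulrA. Qed.

Lemma endo_char : p%:R = 0 :> endo R.
Proof. by apply: endo_ext => x; rewrite endo_mulrnE mulrn_p0. Qed.

Lemma iter_cbr n (z x : R) : iter n (cbr^~ z) x = ((rmul z - lmul z) ^+ n) x.
Proof. by rewrite endo_exprE. Qed.

(** This is [sum_exprM_comm] for a = [lmul z] and b = [rmul z], since b - a is the commutator with
    z. *)
Lemma iter_cbr_pred (z x : R) :
  iter p.-1 (cbr^~ z) x = \sum_(i < p) z ^+ i * x * z ^+ (p.-1 - i).
Proof.
rewrite iter_cbr -(sum_exprM_comm p_pr endo_char (comm_lrmul z)) endo_sumE.
by apply: eq_bigr => i _; rewrite endo_mulE rmulX lmulX mulrA.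
Qed.

(** Here a = - [lmul z] and b = [rmul z - lmul z], so that b - a is right multiplication by z. *)
Lemma sum_signed_iter_cbr (z x : R) :
  \sum_(i < p) (-1) ^+ i * (z ^+ i * iter (p.-1 - i) (cbr^~ z) x) = x * z ^+ p.-1.
Proof.
have cab : GRing.comm (- lmul z) (rmul z - lmul z).
  apply: commrB; apply/commr_sym/commrN; last exact: commr_refl.
  exact/commr_sym/comm_lrmul.
rewrite -rmulX -[in RHS](subrK (lmul z) (rmul z)) -[X in _ + X]opprK.
rewrite -(sum_exprM_comm p_pr endo_char cab) endo_sumE.
apply: eq_bigr => i _; rewrite iter_cbr endo_mulE [in RHS]exprNn.
rewrite -signr_odd -[in RHS]signr_odd.
by case: odd; rewrite ?(mul1r, mulN1r) ?endo_oppE lmulX /= ?expr1 ?expr0 ?(mul1r, mulN1r).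
Qed.

End AdPower.

(** Splits off the first letter. As F sees only the word, this serves as the induction step for sums
    over words. *)
Lemma sum_ffun_word (V : nmodType) n (F : seq bool -> V) :
  \sum_(t : {ffun 'I_n.+1 -> bool}) F [seq t i | i <- enum 'I_n.+1] =
  \sum_(b : bool) \sum_(t : {ffun 'I_n -> bool}) F (b :: [seq t i | i <- enum 'I_n]).
Proof.
rewrite pair_bigA /=.
pose h (q : bool * {ffun 'I_n -> bool}) : {ffun 'I_n.+1 -> bool} :=
  [ffun i => oapp q.2 q.1 (unlift ord0 i)].
pose g (t : {ffun 'I_n.+1 -> bool}) : bool * {ffun 'I_n -> bool} :=
  (t ord0, [ffun i => t (lift ord0 i)]).
rewrite (reindex h) /=; last first.
  exists g => [[b t] _|t _].
    rewrite /g /h ffunE unlift_none /=; congr pair.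
    by apply/ffunP=> i; rewrite !ffunE liftK.
  by apply/ffunP=> i; rewrite ffunE; case: unliftP => [j|] ->; rewrite /= ?ffunE.
apply: eq_bigr => -[b t] _; congr F.
rewrite enum_ordSl /= ffunE unlift_none /=; congr cons.
by rewrite -map_comp; apply: eq_map => i /=; rewrite ffunE liftK.
Qed.

(** The initial letter X is not part of s; hence the later use on [behead (bword t)]. *)
Definition wbr (A : pzRingType) (X Y : A) (s : seq bool) : A :=
  foldl cbr X [seq (if b then Y else X) | b <- s].

(** * Jacobson's formula for the p-th power of a sum *)

Section Jacobson.
Variables (A : nzRingType) (p : nat).
Hypotheses (p_pr : prime p) (p_gt2 : (2 < p)%N) (Ap : p%:R = 0 :> A).
Variables X Y : A.

(** The central indeterminate T counts the occurrences of X, so coefficients sort words by their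
    number of X's. *)
Let z : {poly A} := X%:P * 'X + Y%:P.

(** Each commutator with z appends either X, with a factor T, or Y, with none. The exponent k is
    free because the induction changes it. *)
Lemma iter_cbr_word n (c : A) k :
  iter n (cbr^~ z) (c%:P * 'X^k) =
  \sum_(t : {ffun 'I_n -> bool})
    (foldl cbr c [seq (if b then Y else X) | b <- [seq t i | i <- enum 'I_n]])%:P
      * 'X^(k + count negb [seq t i | i <- enum 'I_n]).
Proof.
elim: n c k => [|n IHn] c k.
  rewrite enum_ord0 /= addn0 big_const.
  by rewrite card_ffun card_bool card_ord /= addr0.
rewrite (sum_ffun_word _ (fun s => (foldl cbr c
  [seq (if b then Y else X) | b <- s])%:P * 'X^(k + count negb s))).
rewrite iterSr big_bool /=.
have -> : cbr (c%:P * 'X^k) z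
    = (cbr c Y)%:P * 'X^k + (cbr c X)%:P * 'X^(k.+1).
  have M u v m l : (u%:P * 'X^m) * (v%:P * 'X^l) = (u * v)%:P * 'X^(m + l) :> {poly A}.
    by rewrite mulrA -(mulrA u%:P) -commr_polyXn mulrA -mulrA -exprD polyCM.
  have -> : z = X%:P * 'X^1 + Y%:P * 'X^0 by rewrite expr0 mulr1.
  rewrite /comm_bracket mulrDr mulrDl !M !polyCB !mulrBl addn0 add0n addn1 add1n.
  by rewrite opprD addrACA addrC.
have iterD u v : iter n (cbr^~ z) (u + v) = iter n (cbr^~ z) u + iter n (cbr^~ z) v.
  by rewrite !iter_cbr endoD.
rewrite iterD !IHn; congr (_ + _); apply: eq_bigr => t _ /=.
by rewrite add1n addnS.
Qed.

(** X need not commute with z, so the Leibniz rule leaves the derivative X in the place of each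
    factor in turn. *)
Lemma deriv_exp_comm n :
  (z ^+ n)^`() = \sum_(i < n) z ^+ i * X%:P * z ^+ (n.-1 - i).
Proof.
have dz : z^`() = X%:P by rewrite /z derivD derivC addr0 deriv_mulC derivX mulr1.
elim: n => [|n IHn]; first by rewrite derivC big_ord0.
rewrite exprSr derivM IHn dz big_ord_recr /= subnn mulr1; congr (_ + _).
rewrite mulr_suml; apply: eq_bigr => i _; rewrite -mulrA -exprSr.
by case: n {IHn} i => [[]//|n] i; rewrite /= -subSn // -ltnS.
Qed.

Lemma size_pencil_exp n : (size (z ^+ n) <= n.+1)%N.
Proof.
apply: leq_trans (size_poly_exp_leq _ _) _; rewrite ltnS.
rewrite -[leqRHS]mul1n leq_mul2r; apply/orP; right.
rewrite size_MXaddC; case: ifP => //= _.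
exact: size_polyC_leq1.
Qed.

Lemma coef_pencil_exp n : (z ^+ n)`_n = X ^+ n.
Proof.
elim: n => [|n IHn]; first by rewrite !expr0 coefC.
rewrite !exprSr {2}/z mulrDr mulrA coefD coefMX /= coefMC IHn coefMC.
by rewrite (nth_default _ (size_pencil_exp n)) mul0r addr0.
Qed.

Lemma foldl_cbr0 (s : seq A) : foldl cbr 0 s = 0.
Proof. by elim: s => //= x s; rewrite /comm_bracket mul0r mulr0 subr0. Qed.

(** The second clause is a multiple rather than a quotient, since A carries no scalars to divide
    by. *)
Lemma jacobson_coef : exists s : nat -> A,
  (X + Y) ^+ p = X ^+ p + Y ^+ p + \sum_(1 <= i < p) s i /\
  forall i, (0 < i)%N ->
    s i *+ i = \sum_(t : {ffun 'I_(p - 2) -> bool} | nx t == i)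
      wbr X Y (behead (bword t)).
Proof.
(* Evaluating z^p at T = 1 sums its coefficients; those of index p and 0 are X^p and Y^p. *)
exists (fun i => (z ^+ p)`_i); split.
  have z1 : z.[1] = X + Y by rewrite /z hornerMXaddC hornerC mulr1.
  have z0 : z.[0] = Y by rewrite /z hornerMXaddC mulr0 add0r.
  rewrite -z1 -horner_exp_comm; last by rewrite /comm_poly mul1r mulr1.
  rewrite (horner_coef_wide _ (size_pencil_exp p)).
  under eq_bigr => i _ do rewrite expr1n mulr1.
  rewrite big_ord_recr /= coef_pencil_exp addrC -addrA; congr (_ + _).
  rewrite -(big_mkord xpredT (fun i => (z ^+ p)`_i)) big_ltn ?prime_gt0 //.
  rewrite -horner_coef0 horner_exp_comm ?z0 //.
  by rewrite /comm_poly z0 mulr0 mul0r.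
(* The multiple is a coefficient of the derivative of z^p, which is the (p-1)-fold commutator of X
   with z. *)
case=> // i _; rewrite -coef_deriv deriv_exp_comm -iter_cbr_pred //; last first.
  by rewrite -polyC_natr Ap.
have -> : p.-1 = (p - 2).+1 by rewrite -subSn ?subSS ?subn1 // ltnW.
have := iter_cbr_word (p - 2).+1 X 0; rewrite expr0 mulr1 => ->.
rewrite (sum_ffun_word _ (fun s => (foldl cbr X
  [seq (if b then Y else X) | b <- s])%:P * 'X^(0 + count negb s))) big_bool /=.
(* Words whose second letter is X vanish because [X, X] = 0; this leaves the words starting with X,
   Y. *)
rewrite [cbr X X]subrr [X in _ + X]big1 => [|t _]; last by rewrite foldl_cbr0 mul0r.
rewrite addr0 coef_sum [RHS]big_mkcond; apply: eq_bigr => t _.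
(* [nx] also counts the initial X, which makes up for the degree lost in differentiating. *)
rewrite coefCM coefXn !add0n /nx /= !add0n add1n eqSS eq_sym.
by case: eqP; rewrite (mulr1, mulr0).
Qed.

End Jacobson.

(** Evaluated at a vector because [endo V] has no scalar multiplication: the inverses of [nx t] act
    on V. *)
Lemma jacobson_endo (K : fieldType) (p : nat) (V : lmodType K) (X Y : endo V) (e : V) :
  prime p -> (2 < p)%N -> p \in [pchar K] ->
  ((X + Y) ^+ p) e = (X ^+ p) e + (Y ^+ p) e
    + \sum_(t : {ffun 'I_(p - 2) -> bool})
        ((nx t)%:R)^-1 *: wbr X Y (behead (bword t)) e.
Proof.
move=> p_pr p_gt2 Kp.
have Ep : p%:R = 0 :> endo V.
  apply: endo_ext => v; rewrite endo_mulrnE.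
  by rewrite /= -scaler_nat pcharf0 // scale0r.
have [s [-> sE]] : exists s : nat -> endo V,
    (X + Y) ^+ p = X ^+ p + Y ^+ p + \sum_(1 <= i < p) s i /\
    forall i, (0 < i)%N -> s i *+ i =
      \sum_(t : {ffun 'I_(p - 2) -> bool} | nx t == i) wbr X Y (behead (bword t)).
  (* Polynomials need a nonzero ring; in the zero ring every equation holds. *)
  have [E0|E1] := eqVneq (1 : endo V) 0.
    have E f : f = 0 :> endo V by rewrite -[f]mul1r E0 mul0r.
    by exists (fun=> 0); split=> [|i _]; rewrite [LHS]E [RHS]E.
  pose A : nzRingType := HB.pack (endo V) (GRing.PzSemiRing_isNonZero.Build (endo V) E1).
  exact: (@jacobson_coef A).
rewrite !endo_addE endo_sumE; congr (_ + _).
(* The first letter is x and the second y, so the count lies strictly between 0 and p and is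
   invertible in K. *)
have nx_bounds t : (0 < @nx p t < p)%N.
  rewrite /nx /= add1n add0n /= -[X in (_ < X)%N](subnK (ltnW p_gt2)) addn2 !ltnS.
  by apply: leq_trans (count_size _ _) _; rewrite size_map size_enum_ord.
transitivity (\sum_(1 <= i < p) \sum_(t : {ffun 'I_(p - 2) -> bool} | nx t == i)
    ((nx t)%:R)^-1 *: wbr X Y (behead (bword t)) e : V).
  apply: eq_big_nat => i /andP[i0 ip].
  have Ki : i%:R != 0 :> K by rewrite -(dvdn_pcharf Kp) gtnNdvd.
  apply: (scalerI Ki); rewrite scaler_nat -endo_mulrnE sE // endo_sumE scaler_sumr.
  by apply: eq_bigr => t /eqP->; rewrite scalerA divff ?scale1r.
rewrite (exchange_big_dep predT) //=; apply: eq_bigr => t _.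
under eq_bigl => i do rewrite eq_sym.
by rewrite big_nat1_eq nx_bounds.
Qed.

(** * Linear maps and homogeneous elements *)

Section LinearFacts.
Variables (K : fieldType) (U V W : lmodType K).

Section Basic.
Variables (f : U -> V) (f_lin : linear f).

Definition linear_of : {linear U -> V} := HB.pack f (GRing.isLinear.Build K U V _ f f_lin).

Lemma linD : {morph f : u v / u + v}. Proof. exact: (raddfD linear_of). Qed.
Lemma linB : {morph f : u v / u - v}. Proof. exact: (raddfB linear_of). Qed.
Lemma linN : {morph f : u / - u}. Proof. exact: (raddfN linear_of). Qed.
Lemma lin0 : f 0 = 0. Proof. exact: (raddf0 linear_of). Qed.
Lemma linZ a : {morph f : u / a *: u}. Proof. by move=> u; exact: (linearZ_LR linear_of). Qed.
Lemma lin_sum I (r : seq I) (P : pred I) E :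
  f (\sum_(i <- r | P i) E i) = \sum_(i <- r | P i) f (E i).
Proof. exact: (raddf_sum linear_of). Qed.

End Basic.

Lemma linear_comp (f : U -> V) (g : V -> W) :
  linear f -> linear g -> linear (fun u => g (f u)).
Proof. by move=> fl gl a u v; rewrite fl gl. Qed.

Lemma linear_plus (f g : U -> V) :
  linear f -> linear g -> linear (fun u => f u + g u).
Proof. by move=> fl gl a u v; rewrite fl gl scalerDr addrACA. Qed.

Lemma linear_scale (f : U -> V) c : linear f -> linear (fun u => c *: f u).
Proof. by move=> fl a u v; rewrite fl scalerDr !scalerA mulrC. Qed.

Lemma linear_opp (f : U -> V) : linear f -> linear (fun u => - f u).
Proof. by move=> fl a u v; rewrite fl opprD scalerN. Qed.

Lemma linear_sum I (r : seq I) (f : I -> U -> V) :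
  (forall i, linear (f i)) -> linear (fun u => \sum_(i <- r) f i u).
Proof.
move=> fl a u v; rewrite scaler_sumr -big_split /=.
by apply: eq_bigr => i _; rewrite fl.
Qed.

End LinearFacts.

Section Homogeneous.
Variables (K : fieldType) (V : lmodType K) (par : bool -> V -> V).
Hypothesis par_grading : grading par.

Lemma homog_par a b v : homog par a v -> par b v = if b == a then v else 0.
Proof. by case: par_grading => _ _ E <-; rewrite E. Qed.

Lemma homogD a u v : homog par a u -> homog par a v -> homog par a (u + v).
Proof. by case: par_grading => l _ _ uE vE; rewrite /homog (linD (l a)) uE vE. Qed.

Lemma homogB a u v : homog par a u -> homog par a v -> homog par a (u - v).
Proof. by case: par_grading => l _ _ uE vE; rewrite /homog (linB (l a)) uE vE. Qed.

Lemma homogZ a c u : homog par a u -> homog par a (c *: u).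
Proof. by case: par_grading => l _ _ uE; rewrite /homog (linZ (l a)) uE. Qed.

End Homogeneous.

(* Cancels opposite terms pairwise, from the last one; loops if a term is repeated. *)
Local Ltac zmod_cancel :=
  rewrite -[LHS]add0r ?(opprD, opprK) ?addrA;
  repeat (match goal with
  | |- _ + - ?t = 0 => rewrite !(addrAC _ t) subrK
  | |- _ + ?t = 0 => rewrite !(addrAC _ (- t)) addrK
  end);
  try reflexivity.

(** * Sign rules in a restricted Lie superalgebra and its module *)

Section Super.
Variables (K : fieldType) (p : nat) (L M : lmodType K).
Variables (parL : bool -> L -> L) (br : L -> L -> L) (pm : L -> L).
Variables (parM : bool -> M -> M) (act : L -> M -> M).
Hypotheses (p_pr : prime p) (p_gt2 : (2 < p)%N) (Kp : p \in [pchar K]).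
Hypothesis HL : restricted_lie_superalgebra p parL br pm.
Hypothesis HM : restricted_module p parL br pm parM act.

Local Notation s := (@sgn K).

Let parL_lin b : linear (parL b). Proof. by case: HL => -[[[]]]. Qed.
Let parM_lin b : linear (parM b). Proof. by case: HM => -[]. Qed.
Let brl v : linear (br^~ v). Proof. by case: HL => -[[_ []]]. Qed.
Let brr u : linear (br u). Proof. by case: HL => -[[_ []]]. Qed.
Let actl m : linear (act^~ m). Proof. by case: HM => _ []. Qed.
Let actr u : linear (act u). Proof. by case: HM => _ []. Qed.

Let parL_dec u : parL false u + parL true u = u.
Proof. by case: HL => -[[[]]]. Qed.
Let parM_dec m : parM false m + parM true m = m.
Proof. by case: HM => -[]. Qed.
Let parL_par b c u : parL b (parL c u) = if b == c then parL c u else 0.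
Proof. by case: HL => -[[[]]]. Qed.
Let parM_par b c m : parM b (parM c m) = if b == c then parM c m else 0.
Proof. by case: HM => -[]. Qed.

Let parL_homog b u : homog parL b (parL b u).
Proof. by rewrite /homog parL_par eqxx. Qed.

Let parLE a b u : homog parL a u -> parL b u = if b == a then u else 0.
Proof. by apply: homog_par; case: HL => -[[]]. Qed.
Let parME a b m : homog parM a m -> parM b m = if b == a then m else 0.
Proof. by apply: homog_par; case: HM. Qed.

Let br_homog a b u v : homog parL a u -> homog parL b v -> homog parL (a (+) b) (br u v).
Proof. by case: HL => -[_ H _ _ _] _ _ _ _; apply: H. Qed.
Let act_homog a b u m : homog parL a u -> homog parM b m -> homog parM (a (+) b) (act u m).
Proof. by case: HM => _ _ H _ _; apply: H. Qed.
Let br_anti a b u v : homog parL a u -> homog parL b v -> br u v = - (s (a && b) *: br v u).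
Proof. by case: HL => -[_ _ H _ _] _ _ _ _; apply: H. Qed.
Let act_br a b u v m : homog parL a u -> homog parL b v ->
  act (br u v) m = act u (act v m) - s (a && b) *: act v (act u m).
Proof. by case: HM => _ _ _ H _; apply: H. Qed.
Let pm_even x : homog parL false x -> homog parL false (pm x).
Proof. by case: HL => _ H _ _ _; apply: H. Qed.


(** The cyclic identity rearranged by antisymmetry, so that all brackets in [d2h] become left-normed
    and can cancel. *)
Lemma jacobi_left a b c u v w :
  homog parL a u -> homog parL b v -> homog parL c w ->
  br u (br v w) = br (br u v) w - s (b && c) *: br (br u w) v.
Proof.
move=> ua vb wc.
have jac : s (a && c) *: br u (br v w) + s (b && a) *: br v (br w u)
  + s (c && b) *: br w (br u v) = 0 by case: HL => -[_ _ _ H _] _ _ _ _; apply: H.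
have := jac; rewrite (br_anti wc ua) (linN (brr v)) (linZ (brr v)).
rewrite (br_anti vb (br_homog ua wc)) (br_anti wc (br_homog ua vb)).
move=> /eqP; rewrite -addrA addr_eq0 => /eqP.
case: a b c {ua vb wc jac} => [] [] [] /=; rewrite !(scaleN1r, scale1r) ?(opprK, opprD);
  first [move=> -> | move=> E; apply: oppr_inj; rewrite E];
  by rewrite ?(opprK, opprD) // addrC.
Qed.

Lemma act_br_even u y m : homog parL false y ->
  act (br u y) m = act u (act y m) - act y (act u m).
Proof.
move=> y0; rewrite -[u]parL_dec (linD (brl y)) !(linD (actl _)) (linD (actr y)).
rewrite !(act_br _ (parL_homog _ u) y0) !andbF !scale1r opprD.
by rewrite addrACA.
Qed.

Lemma br_even_anti u y : homog parL false y -> br u y = - br y u.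
Proof.
move=> y0; rewrite -[u]parL_dec (linD (brl y)) (linD (brr y)).
by rewrite !(br_anti (parL_homog _ u) y0) !andbF !scale1r opprD.
Qed.

(** Collapses the parity sums in [comp1], [comp2] and [d1CE] on homogeneous arguments, where the
    other component is 0. *)
Lemma sum_par (V : zmodType) (F : bool -> L -> V) a u :
  (forall b, F b 0 = 0) -> homog parL a u -> \sum_b F b (parL b u) = F a u.
Proof.
move=> F0 ua; rewrite (bigD1 a) //= (parLE _ ua) eqxx big1 ?addr0 // => b nba.
by rewrite (parLE _ ua) (negPf nba).
Qed.

(** After expansion by the Jacobi and module identities, terms cancel in pairs for each of the 16
    parity patterns. The formula for phi is asked on homogeneous pairs, where [comp2_d1CE] provides
    it. *)
Lemma d2h_d1h (j a b c : bool) (phi : L -> L -> M) (f : L -> M) u v w :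
  linear f -> homog parL a u -> homog parL b v -> homog parL c w ->
  (forall a b u v, homog parL a u -> homog parL b v ->
     phi u v = d1h br act j a b f u v) ->
  d2h br act j a b c phi u v w = 0.
Proof.
move=> fl ua vb wc phiE; rewrite /d2h.
rewrite (phiE _ _ _ _ (br_homog ua vb) wc) (phiE _ _ _ _ (br_homog ua wc) vb).
rewrite (phiE _ _ _ _ ua (br_homog vb wc)) (phiE _ _ _ _ vb wc) (phiE _ _ _ _ ua wc).
rewrite (phiE _ _ _ _ ua vb) /d1h (jacobi_left ua vb wc).
rewrite (act_br _ ua vb) (act_br _ ua wc) (act_br _ vb wc).
rewrite (linB fl) (linZ fl) !(linD (actr _)) !(linN (actr _)) !(linZ (actr _)).
case: j a b c {ua vb wc phiE} => [] [] [] [] /=;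
  rewrite ?(scaleN1r, scale1r); zmod_cancel.
Qed.

(** * The coboundary of psi: bilinearity, components, and d^2 d^1 = 0 *)

Section Cochain.
Variables (psi : L -> M) (psi_lin : linear psi).

Local Notation psi_ j := (comp1 parL parM j psi).
Local Notation d1 := (d1CE parL br parM act psi).

Lemma comp1_linear j : linear (psi_ j).
Proof.
apply: linear_sum => a; apply: (@linear_comp _ _ _ _ (fun u => psi (parL a u))) => //.
exact: linear_comp.
Qed.

Lemma comp1E j a u : homog parL a u -> psi_ j u = parM (a (+) j) (psi u).
Proof.
move=> ua; rewrite /comp1 (sum_par (F := fun a u => parM (a (+) j) (psi u)) _ ua) //.
by move=> b; rewrite (lin0 psi_lin) (lin0 (parM_lin _)).
Qed.

Lemma comp1_homog j a u : homog parL a u -> homog parM (a (+) j) (psi_ j u).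
Proof. by move=> ua; rewrite (comp1E _ ua) /homog parM_par eqxx. Qed.

Lemma comp1_sum u : psi_ true u + psi_ false u = psi u.
Proof.
have E a : psi_ true (parL a u) + psi_ false (parL a u) = psi (parL a u).
  rewrite !(comp1E _ (parL_homog a u)) -[RHS]parM_dec.
  by case: a => //=; rewrite addrC.
rewrite -[u]parL_dec !(linD (comp1_linear _)) (linD psi_lin) -!E.
exact: addrACA.
Qed.

Lemma d1h_bilin j a b f : linear f -> bilin (d1h br act j a b f).
Proof.
move=> fl; split=> [u|v]; rewrite /d1h.
- apply: linear_plus; first (apply: linear_plus; first exact: (linear_comp (brr u))).
    by apply: linear_opp; apply: linear_scale; apply: (linear_comp fl).
  exact: linear_scale.
- apply: linear_plus; first (apply: linear_plus).
  + exact: (linear_comp (brl v)).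
  + by apply: linear_opp; apply: linear_scale.
  + by apply: linear_scale; apply: (linear_comp fl).
Qed.

Lemma d1CE_bilin : bilin d1.
Proof.
split=> [u|v]; apply: linear_sum => j; apply: linear_sum => a; apply: linear_sum => b;
  have [dr dl] := d1h_bilin j a b (comp1_linear j).
- exact: (linear_comp (parL_lin b) (dr _)).
- exact: (linear_comp (parL_lin a) (dl _)).
Qed.

Lemma d1CE_homog a b u v : homog parL a u -> homog parL b v ->
  d1 u v = \sum_j d1h br act j a b (psi_ j) u v.
Proof.
move=> ua vb; apply: eq_bigr => j _.
rewrite (sum_par (F := fun a u => \sum_b d1h br act j a b (psi_ j) u (parL b v)) _ ua).
  rewrite (sum_par (F := fun b v => d1h br act j a b (psi_ j) u v) _ vb) // => c.
  by have [/(_ u) dr _] := d1h_bilin j a c (comp1_linear j); rewrite (lin0 dr).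
move=> c; rewrite big1 // => e _.
by have [_ /(_ (parL e v)) dl] := d1h_bilin j c e (comp1_linear j); rewrite (lin0 dl).
Qed.

Lemma d1h_homog j a b u v : homog parL a u -> homog parL b v ->
  homog parM (a (+) b (+) j) (d1h br act j a b (psi_ j) u v).
Proof.
move=> ua vb; have gM : grading parM by case: HM.
apply: (homogD gM).
  apply: (homogB gM); first exact: comp1_homog (br_homog ua vb).
  by apply: (homogZ gM); rewrite -addbA; apply: act_homog (comp1_homog _ vb).
apply: (homogZ gM); rewrite [a (+) b]addbC -addbA.
exact: act_homog (comp1_homog _ ua).
Qed.

(** The summand of [d1CE] built from [psi_ i] has degree i by [d1h_homog], so projecting to degree j
    keeps only i = j. *)
Lemma comp2_d1CE j a b u v : homog parL a u -> homog parL b v ->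
  comp2 parL parM j d1 u v = d1h br act j a b (psi_ j) u v.
Proof.
move=> ua vb; have [dr dl] := d1CE_bilin.
rewrite /comp2 (sum_par (F := fun a u => \sum_b parM (a (+) b (+) j) (d1 u (parL b v))) _ ua).
  rewrite (sum_par (F := fun b v => parM (a (+) b (+) j) (d1 u v)) _ vb) => [|c].
    rewrite (d1CE_homog ua vb) (lin_sum (parM_lin _)) (bigD1 j) //= big1 => [|i nij].
      by rewrite addr0 (d1h_homog j ua vb).
    rewrite (parME _ (d1h_homog i ua vb)); case: eqP => // /addbI eji.
    by rewrite eji eqxx in nij.
  by rewrite (lin0 (dr u)) (lin0 (parM_lin _)).
by move=> c; rewrite big1 // => e _; rewrite (lin0 (dl _)) (lin0 (parM_lin _)).
Qed.

Lemma d2CE_d1CE u v w : d2CE parL br parM act d1 u v w = 0.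
Proof.
do 4![rewrite /d2CE big1 // => ? _].
apply: d2h_d1h (comp1_linear _) _ _ _ _; try exact: parL_homog.
by move=> a b u' v'; apply: comp2_d1CE.
Qed.

Lemma d1CE_alternating : super_alternating parL d1.
Proof.
move=> a b u v ua vb; rewrite (d1CE_homog ua vb) (d1CE_homog vb ua).
rewrite scaler_sumr -sumrN; apply: eq_bigr => j _.
rewrite /d1h (br_anti ua vb) (linN (comp1_linear j)) (linZ (comp1_linear j)).
apply/eqP; rewrite -subr_eq0 opprK; apply/eqP.
by case: j a b {ua vb} => [] [] [] /=; rewrite ?(scaleN1r, scale1r); zmod_cancel.
Qed.

Lemma d1CE_even u v : homog parL false u -> homog parL false v ->
  d1 u v = psi (br u v) - act u (psi v) + act v (psi u).
Proof.
move=> u0 v0; rewrite (d1CE_homog u0 v0) big_bool /d1h /= !scale1r.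
rewrite -(comp1_sum (br u v)) -(comp1_sum u) -(comp1_sum v) !(linD (actr _)).
by rewrite addrACA [X in X + _]addrACA -opprD.
Qed.

(** * Compatibility of ind^1 psi *)

(* The operators [aug u] on M + K record both the action and [psi]: by Jacobson's
   formula in End(M + K), evaluated at (0, 1), [psi] satisfies the compatibility
   identity without being a derivation. *)
Fact aug_subproof u :
  {morph (fun q : M * K^o => (act u q.1 + q.2 *: psi u, 0 : K^o)) : q r / q + r}.
Proof.
move=> q r /=; congr pair; last by rewrite addr0.
by rewrite (linD (actr u)) scalerDl addrACA.
Qed.

Definition aug u : endo (M * K^o)%type := Endo (aug_subproof u).

Lemma augE u q : aug u q = (act u q.1 + q.2 *: psi u, 0). Proof. by []. Qed.

Lemma augD u v : aug (u + v) = aug u + aug v.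
Proof.
apply: endo_ext => q; rewrite endo_addE !augE; congr pair; last by rewrite /= addr0.
by rewrite (linD (actl _)) (linD psi_lin) scalerDr addrACA.
Qed.

Lemma aug_exp u n : (aug u ^+ n.+1) (0, 1) = (iter n (act u) (psi u), 0).
Proof.
rewrite endo_exprE; elim: n => [|n IHn].
  by rewrite /= (lin0 (actr u)) add0r scale1r.
by rewrite iterS IHn augE /= scale0r addr0.
Qed.

(* [compat_term] for words of arbitrary length, so as to induct on the word *)
Definition compat_sum (phi : L -> L -> M) (w : seq L) : M :=
  \sum_(0 <= k < (size w).-1) (-1) ^+ k *:
    act_tail act w k (phi (lbr br (take (size w - k - 1) w)) (nth 0 w (size w - k - 1))).

(** The term k = 0 is phi([w], y). In every other term y acts last; removing it lowers k by one,
    whence the minus sign. *)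
Lemma compat_sum_rcons phi w y : (0 < size w)%N ->
  compat_sum phi (rcons w y) = phi (lbr br w) y - act y (compat_sum phi w).
Proof.
move=> w0; rewrite /compat_sum size_rcons /= big_ltn //.
rewrite subn0 subn1 /= expr0 scale1r -cats1 take_size_cat // nth_cat ltnn subnn /=.
rewrite cats1 /act_tail subn0 -(size_rcons w y) drop_size /=; congr (_ + _).
rewrite big_add1 (lin_sum (actr y)) -sumrN.
apply: eq_big_nat => k /andP[_ ltk]; rewrite (linZ (actr y)).
have lekw : (k < size w)%N by rewrite (leq_trans ltk) // leq_pred.
rewrite exprS mulN1r scaleNr size_rcons subSS drop_rcons ?leq_subr // rev_rcons /=.
have ltw : (size w - k - 1 < size w)%N.
  by rewrite -subnDA addn1 ltn_subrL w0.
by rewrite nth_rcons ltw -cats1 takel_cat // ltnW.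
Qed.

Lemma compat_termE phi w : size w = p -> compat_term p br act phi w = compat_sum phi w.
Proof.
move=> sw; rewrite /compat_sum sw big_ltn; last first.
  by rewrite -ltnS prednK ?prime_gt0 // ltnW.
by rewrite /compat_term subn0 subn1 expr0 scale1r /act_tail subn0 drop_size.
Qed.

Lemma lbr_rcons w y : (0 < size w)%N -> lbr br (rcons w y) = br (lbr br w) y.
Proof. by case: w => // x w _; rewrite /lbr /= foldl_rcons. Qed.

Lemma lbr_even w : {in w, forall y, homog parL false y} -> homog parL false (lbr br w).
Proof.
have parL0 : homog parL false 0 by exact: lin0.
elim/last_ind: w => [//|w y IHw] wE.
have yE : homog parL false y by apply: wE; rewrite mem_rcons mem_head.
have [->|w0] := eqVneq w [::]; first by [].
rewrite lbr_rcons ?lt0n ?size_eq0 //; apply: (@br_homog false false) => //.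
by apply: IHw => v vw; apply: wE; rewrite mem_rcons inE vw orbT.
Qed.

(** The two claims go together: the commutator of C with [aug y] at (0, 1) needs C at (psi(y), 0).
    The second then follows from [compat_sum_rcons] and the formula for d^1 psi on even elements. *)
Lemma aug_word x w : {in x :: w, forall y, homog parL false y} ->
  (forall m, foldl cbr (aug x) [seq aug y | y <- w] (m, 0) = (act (lbr br (x :: w)) m, 0)) /\
  foldl cbr (aug x) [seq aug y | y <- w] (0, 1) =
    (psi (lbr br (x :: w)) - compat_sum d1 (x :: w), 0).
Proof.
elim/last_ind: w => [|w y IHw] wE.
  rewrite /compat_sum big_geq // subr0; split=> [m|].
    by rewrite /= scale0r addr0.
  by rewrite /= (lin0 (actr x)) add0r scale1r.
have yE : homog parL false y by apply: wE; rewrite inE mem_rcons mem_head orbT.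
have wE' : {in x :: w, forall y, homog parL false y}.
  by move=> v vw; apply: wE; move: vw; rewrite !inE mem_rcons inE => /orP[]->; rewrite ?orbT.
have [IH0 IH1] := IHw wE'; have cE := lbr_even wE'.
rewrite map_rcons foldl_rcons -rcons_cons lbr_rcons // compat_sum_rcons //.
set C := foldl _ _ _ in IH0 IH1 *.
have CE q : cbr C (aug y) q = C (aug y q) - aug y (C q) by [].
have pB (a c : M) (b d : K^o) : (a, b) - (c, d) = (a - c, b - d) by [].
split=> [m|]; rewrite CE augE /=.
  rewrite scale0r addr0 !IH0 /= scale0r addr0 act_br_even //.
  by rewrite pB subr0.
rewrite (lin0 (actr y)) add0r scale1r IH0 IH1 /= scale0r addr0.
rewrite pB subr0; congr pair; rewrite d1CE_even // (linB (actr y)).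
apply/eqP; rewrite -subr_eq0; apply/eqP; zmod_cancel.
Qed.

Lemma ind1_compatible : phi_compatible p parL br act d1 (ind1 p pm act psi).
Proof.
have p0 : p = p.-1.+1 by rewrite prednK ?prime_gt0.
split=> [l x x0|x y x0 y0].
  have iterZ n m : iter n (act (l *: x)) (l *: m) = l ^+ n.+1 *: iter n (act x) m.
    elim: n => [|n IHn]; first by rewrite expr1.
    by rewrite !iterS IHn (linZ (actl _)) (linZ (actr _)) scalerA -exprS.
  rewrite /ind1 (linZ psi_lin) iterZ -p0 scalerBr.
  by case: HL => _ _ -> //; rewrite (linZ psi_lin).
have wordE t : wbr (aug x) (aug y) (behead (@bword p t)) (0, 1) =
    (psi (lbr br (word x y t)) - compat_term p br act d1 (word x y t), 0).
  rewrite compat_termE; last first.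
    by rewrite /word size_map /bword /= size_map size_enum_ord -addn2 subnK // ltnW.
  rewrite /wbr (_ : [seq _ | b <- _] =
    [seq aug v | v <- [seq (if b then y else x) | b <- behead (bword t)]]).
    apply: (proj2 (aug_word _)) => v.
    by rewrite inE => /orP[/eqP->//|/mapP[[] _ ->]].
  by rewrite -map_comp; apply: eq_map => -[].
(* The M-component gives the expansion of (x+y)^{p-1} psi(x+y). *)
have := jacobson_endo (aug x) (aug y) (0, 1) p_pr p_gt2 Kp.
rewrite -augD p0 !aug_exp -p0 => /(congr1 fst) /=; rewrite raddf_sum /=.
under eq_bigr => t _ do rewrite wordE /= scalerBr.
rewrite sumrB /ind1; case: HL => _ _ _ -> // _; rewrite !(linD psi_lin) => ->.
rewrite [in LHS]/jac_sum (lin_sum psi_lin); under [in LHS]eq_bigr do rewrite (linZ psi_lin).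
by apply/eqP; rewrite -subr_eq0; apply/eqP; zmod_cancel.
Qed.

Lemma sum_signed_iter_act (m : M) x y : homog parL false y ->
  \sum_(i < p) (-1) ^+ i *: iter i (act y) (act (iter (p.-1 - i) (br^~ y) x) m)
  = act x (iter p.-1 (act y) m).
Proof.
move=> y0; pose E u : endo M := Endo (linD (actr u)).
have Ep : p%:R = 0 :> endo M.
  by apply: endo_ext => v; rewrite endo_mulrnE /= -scaler_nat pcharf0 // scale0r.
have iterE n : iter n (cbr^~ (E y)) (E x) = E (iter n (br^~ y) x).
  by elim: n => //= n ->; apply: endo_ext => v /=; rewrite act_br_even.
have := sum_signed_iter_cbr p_pr Ep (E y) (E x).
move=> /(congr1 (fun g : endo M => g m)).
rewrite endo_sumE endo_mulE endo_exprE /= => <-; apply: eq_bigr => i _.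
have -> : iter i (act y) (act (iter (p.-1 - i) (br^~ y) x) m)
    = (E y ^+ i * E (iter (p.-1 - i) (br^~ y) x)) m.
  by rewrite endo_mulE endo_exprE.
rewrite iterE -signr_odd -[in RHS]signr_odd.
by case: odd; rewrite ?expr1 ?expr0 ?(scale1r, scaleN1r) ?(mul1r, mulN1r).
Qed.

Lemma iter_br_pm x y : homog parL false y -> iter p (br^~ y) x = br x (pm y).
Proof.
move=> y0; have E n : iter n (br^~ y) x = (-1) ^+ n *: iter n (br y) x.
  elim: n => [|n IHn]; first by rewrite scale1r.
  by rewrite !iterS IHn (linZ (brl y)) br_even_anti // scalerN exprS mulN1r scaleNr.
rewrite E (br_even_anti _ (pm_even y0)); case: HL => _ _ _ _ -> //.
rewrite -signr_odd (_ : odd p) ?expr1 ?scaleN1r //.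
by case: (even_prime p_pr) p_gt2 => [->|].
Qed.

Lemma ind2h_d1h j a (phi : L -> L -> M) (omega f : L -> M) x y :
  linear f -> homog parL a x -> homog parL false y ->
  (forall a b u v, homog parL a u -> homog parL b v ->
     phi u v = d1h br act j a b f u v) ->
  omega y = f (pm y) - iter p.-1 (act y) (f y) ->
  ind2h p br pm act j a phi omega x y = 0.
Proof.
move=> fl xa y0 phiE omegaE; rewrite /ind2h omegaE.
rewrite (phiE _ _ _ _ xa (pm_even y0)) {1}/d1h /= scale1r.
pose u k := iter k (br^~ y) x.
have ua k : homog parL a (u k).
  by elim: k => // k IHk; rewrite -[a]addbF; apply: br_homog.
have iterD n : {morph iter n (act y) : m m' / m + m'}.
  by elim: n => // n IHn m m'; rewrite !iterS IHn (linD (actr y)).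
have iterZ n c m : iter n (act y) (c *: m) = c *: iter n (act y) m.
  by elim: n => // n IHn; rewrite !iterS IHn (linZ (actr y)).
pose T i := - ((-1) ^+ i *: iter i (act y) (f (u (p - i)%N))).
have p0 : p.-1.+1 = p by rewrite prednK ?prime_gt0.
have -> : \sum_(i < p) (-1) ^+ i *: iter i (act y) (phi (u (p.-1 - i)%N) y)
    = \sum_(i < p) (T i.+1 - T i) - sgn K (a && j) *: act x (iter p.-1 (act y) (f y)).
  rewrite -(sum_signed_iter_act _ _ y0) scaler_sumr -sumrB; apply: eq_bigr => i _.
  rewrite (phiE _ _ _ _ (ua _) y0) /d1h /= scale1r.
  have pi : (p - i = (p.-1 - i).+1)%N by rewrite -subSn ?p0 // -ltnS p0.
  rewrite /T opprK -[X in (X - i.+1)%N]p0 subSS pi.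
  rewrite exprS mulN1r scaleNr opprK iterSr.
  rewrite -scaleNr !iterD !iterZ !scalerDr !scalerA mulrN scaleNr mulrC.
  by rewrite addrC addrA.
rewrite -(big_mkord xpredT (fun i => T i.+1 - T i)) telescope_sumr ?leq0n // /T.
rewrite subnn subn0 expr0 scale1r /u /= iter_br_pm //.
have -> : (-1) ^+ p = -1 :> K.
  rewrite -signr_odd (_ : odd p) //.
  by case: (even_prime p_pr) p_gt2 => [->|].
rewrite scaleN1r !opprK; case: HM => _ _ _ _ -> //.
rewrite (linB (actr x)) scalerBr [j && a]andbC.
zmod_cancel.
Qed.

Lemma parM_act_even b y m : homog parL false y -> parM b (act y m) = act y (parM b m).
Proof.
move=> y0; have E c : homog parM c (act y (parM c m)).
  by rewrite -[c]addFb; apply: act_homog => //; rewrite /homog parM_par eqxx.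
rewrite -[m in LHS]parM_dec (linD (actr y)) (linD (parM_lin b)).
rewrite (parME _ (E false)) (parME _ (E true)).
by case: b; rewrite /= ?add0r ?addr0.
Qed.

Lemma ind2_d1CE x y : homog parL false y ->
  ind2 p parL br pm parM act d1 (ind1 p pm act psi) x y = 0.
Proof.
move=> y0; rewrite /ind2 big1 // => j _; rewrite big1 // => a _.
apply: (ind2h_d1h (comp1_linear j) _ y0); first exact: parL_homog.
  by move=> *; apply: comp2_d1CE.
rewrite /ind1 (linB (parM_lin j)) (comp1E j y0) (comp1E j (pm_even y0)) !addFb.
congr (_ - _); elim: p.-1 => //= n IHn.
by rewrite parM_act_even // IHn.
Qed.

End Cochain.

End Super.

Theorem mainTheorem2 (K : fieldType) (p : nat) (L M : lmodType K)
  (parL : bool -> L -> L) (br : L -> L -> L) (pm : L -> L)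
  (parM : bool -> M -> M) (act : L -> M -> M) :
  prime p -> (2 < p)%N -> p \in [pchar K] ->
  restricted_lie_superalgebra p parL br pm ->
  restricted_module p parL br pm parM act ->
  forall psi : L -> M, linear psi ->
    [/\ inC2 p parL br act (d1CE parL br parM act psi) (ind1 p pm act psi),
        (forall u v w, d2CE parL br parM act (d1CE parL br parM act psi) u v w = 0) &
        (forall x y, homog parL false y ->
           ind2 p parL br pm parM act (d1CE parL br parM act psi) (ind1 p pm act psi) x y = 0)].

Proof.
move=> p_pr p_gt2 Kp HL HM psi psi_lin; split=> [|u v w|x y y0].
- split; first exact: (d1CE_bilin HL HM psi_lin).
    exact: (d1CE_alternating HL HM psi_lin).
  exact: ind1_compatible.
- exact: (d2CE_d1CE HL HM psi_lin u v w).
- exact: (ind2_d1CE p_pr p_gt2 Kp HL HM psi_lin x y0).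
Qed.
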